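(* For every $n\ge1$, $$F_n(u,v):=\prod_{q=1}^n\left(1+v(e^{u/q}-1)\right)=\sum_{i,j\ge0}E_{i,j}(n)\,v^iu^j.$$ In particular, $[u^jv^i]F_n(u,v)=E_{i,j}(n)$ for all $i,j\ge0$.
   Context: For a partition $\mu=(\mu_1,\ldots,\mu_i)$, $\mu\vdash j$ means $\mu_1+\cdots+\mu_i=j$ and $\ell(\mu)=i$ is the number of positive parts. $m_\mu(x_1,\ldots,x_n)$ is the monomial symmetric polynomial: the sum of all distinct monomials obtained by assigning the exponents $\mu_1,\ldots,\mu_i$ to distinct variables among $x_1,\ldots,x_n$ ($0$ if $i>n$). For $n\ge1$, $$E_{i,j}(n)=\sum_{\mu\vdash j,\ \ell(\mu)=i}\frac{m_\mu(1,1/2,\ldots,1/n)}{\mu_1!\cdots\mu_i!},\qquad E_{0,0}(n)=1,$$ with empty sums equal to $0$. $[u^jv^i]$ denotes extraction of the coefficient of $u^jv^i$ in the power series expansion at the origin. *)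

(* Defs.v *)
From HB Require Import structures.
From mathcomp Require Import all_boot all_order all_algebra.
From mathcomp Require Import complex finmap.
From mathcomp Require Import all_classical all_reals all_analysis.
From mathcomp Require Import summability.

Set Implicit Arguments.
Unset Strict Implicit.
Unset Printing Implicit Defensive.

Import Order.TTheory GRing.Theory Num.Theory.
Import numFieldNormedType.Exports.

Local Open Scope ring_scope.
Local Open Scope classical_set_scope.

Definition is_partition (j : nat) (mu : seq nat) : bool :=
  [&& sorted geq mu, all (leq 1) mu & sumn mu == j].

(* The exponent vector of the monomial obtained by giving the exponent mu_t to
   the variable x_(g t), for each t. *)
Definition exponents (n : nat) (mu : seq nat) (g : {ffun 'I_(size mu) -> 'I_n}) :
    {ffun 'I_n -> nat} :=
  [ffun k => (\sum_(t < size mu | g t == k) nth 0 mu t)%N].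

(* Several assignments g may give the same monomial (permuting equal parts
   of mu); undup keeps each monomial once. *)
Definition distinct_monomials (n : nat) (mu : seq nat) :
    seq {ffun 'I_n -> nat} :=
  undup [seq exponents g | g : {ffun 'I_(size mu) -> 'I_n} in
                             fun g : {ffun _ -> _} => injectiveb g].

Definition monomial_sym (K : numFieldType) (n : nat) (mu : seq nat)
    (x : 'I_n -> K) : K :=
  \sum_(a <- distinct_monomials n mu) \prod_(k < n) x k ^+ a k.

(* The parts of a partition of j are at most j, so the partitions of j with
   exactly i parts are the i.-tuples over 'I_j.+1 satisfying is_partition. The
   empty tuple is the only partition for i = j = 0, and m_nil = 1, so that
   E_coef K n 0 0 = 1. *)
Definition E_coef (K : numFieldType) (n i j : nat) : K :=
  \sum_(mu : i.-tuple 'I_j.+1 | is_partition j (map val mu))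
    monomial_sym (map val mu) (fun q : 'I_n => q.+1%:R^-1)
      / \prod_(a <- map val mu) (a`!)%:R.

Section ComplexAnalysis.
Variable R : realType.
Local Notation C := R[i].

Definition cexp (z : C) : C :=
  let: (a +i* b)%C := z in (expR a * cos b +i* (expR a * sin b))%C.

Definition F_fun (n : nat) (u v : C) : C :=
  \prod_(1 <= q < n.+1) (1 + v * (cexp (u / q%:R) - 1)).

(* sum_(i, j >= 0) c i j v^i u^j = l, as an unconditional (equivalently,
   absolutely convergent) double series: convergence along the net of finite
   subsets of nat * nat. R[i]^o is R[i] with the topology of its modulus. *)
Definition double_series_sums_to (c : nat -> nat -> C) (u v l : C) : Prop :=
  partial_sum (fun p : nat * nat => (c p.1 p.2 * v ^+ p.1 * u ^+ p.2 : C^o))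
    @ totally --> (l : C^o).

Definition power_series_expansion_at0 (F : C -> C -> C)
    (c : nat -> nat -> C) : Prop :=
  exists2 r : C, 0 < r &
    forall u v : C, `|u| < r -> `|v| < r ->
      double_series_sums_to c u v (F u v).

(* [u^j v^i] F = a : F has a power series expansion at the origin, and in every
   such expansion the coefficient of u^j v^i is a. *)
Definition has_coefficient (F : C -> C -> C) (j i : nat) (a : C) : Prop :=
  (exists c, power_series_expansion_at0 F c) /\
  (forall c, power_series_expansion_at0 F c -> c i j = a).

End ComplexAnalysis.

(* Main.v *)
Require Import Defs.
From mathcomp Require Import all_boot all_order all_algebra.
From mathcomp Require Import complex all_classical all_reals all_analysis.
From mathcomp Require Import finmap summability.
From mathcomp Require Import ring lra.
Import Order.TTheory GRing.Theory Num.Theory.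
Import numFieldNormedType.Exports.
Local Open Scope ring_scope.

#[local] Existing Instance totally_filter.

(** Write x_k = 1/k.  The factor of index k is
<<
      1 + v (e^{u x_k} - 1) = \sum_(b >= 0) v^[b > 0] (u x_k)^b / b!,
>>
    so multiplying out the n factors gives one term for each exponent vector
    a = (a_1, ..., a_n), namely
<<
      v^{#{k | a_k > 0}} u^{a_1 + ... + a_n} \prod_k x_k^{a_k} / a_k!.
>>
    Sorting the nonzero entries of a yields a partition mu, with
    #{k | a_k > 0} parts and sum a_1 + ... + a_n; the vectors that yield mu are
    exactly the distinct monomials of m_mu, and \prod_k a_k! is the product of
    the factorials of the parts of mu.  Collecting the vectors by their
    bidegree therefore gives E_{i,j}(n) as the coefficient of v^i u^j
    ([E_coef_box]).

    Convergence.  All vectors with entries at most N contribute the finite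
    product F_N obtained by truncating the exponentials at degree N.  A finite
    set A of bidegrees that contains those of all these vectors has a partial
    sum that differs from F_N(u, v) only by terms of vectors with an entry
    above N, hence by at most F_M(|u|, |v|) - F_N(|u|, |v|) for M large
    ([partial_sum_dist]).  As F_N converges at (u, v) and at (|u|, |v|), this is
    unconditional convergence to F ([E_coef_sums]).  The argument uses of the
    exponential only that it is the sum of its power series, which for
    e^a (cos b + i sin b) follows from the real series of exp, cos and sin and
    from the addition formula, proved by the same comparison of truncations
    ([exp_partialD_cvg]).

    Uniqueness of the coefficients.  If a double series d sums to 0 near the
    origin and d is not 0, let (i0, j0) be the lexicographically first index
    with d_{i0,j0} <> 0.  Along the curve v = t^(j0+1), u = t its term has
    strictly smaller order in t than all other nonzero terms, so dividing by
    this power of t and letting t tend to 0 gives d_{i0,j0} = 0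
    ([double_series_zero]). *)

(** * Exponent vectors and monomial symmetric polynomials *)

Section MonomialCount.
Set Implicit Arguments.
Unset Strict Implicit.

Definition positive_exponents {n : nat} (a : {ffun 'I_n -> nat}) : seq nat :=
  [seq a k | k <- enum 'I_n & (0 < a k)%N].

Lemma perm_eq_map_lift (S T : eqType) (f : S -> T) (s : seq S) (t : seq T) :
  perm_eq t [seq f x | x <- s] ->
  exists2 s' : seq S, perm_eq s' s & t = [seq f x | x <- s'].
Proof.
case: s => [|x s] ts; first by exists [::] => //; apply/perm_nilP.
have /(perm_iotaP (f x)) [Is pI ->] := ts.
exists [seq nth x (x :: s) i | i <- Is].
  rewrite -[X in perm_eq _ X](mkseq_nth x) /mkseq.
  by rewrite perm_map//; move: pI; rewrite size_map.
rewrite -map_comp; apply/eq_in_map => i.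
rewrite (perm_mem pI) mem_iota add0n size_map => /andP[_].
exact: (@nth_map _ x _ (f x) f i (x :: s)).
Qed.

Lemma exponents_inj (n : nat) (mu : seq nat) (g : {ffun 'I_(size mu) -> 'I_n}) t :
  injective g -> exponents g (g t) = nth 0%N mu t.
Proof.
move=> injg; rewrite ffunE (eq_bigl (pred1 t)) ?big_pred1_eq// => s /=.
by rewrite inj_eq.
Qed.

Lemma exponents_notin (n : nat) (mu : seq nat) (g : {ffun 'I_(size mu) -> 'I_n}) k :
  k \notin codom g -> exponents g k = 0%N.
Proof.
move=> kg; rewrite ffunE big_pred0// => t; apply/negbTE.
by apply: contra kg => /eqP <-; apply: codom_f.
Qed.

(** An injective assignment of the parts of mu to variables is recovered from
    its exponent vector up to the order of equal parts: this vector determines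
    mu, and conversely the variables with nonzero exponent can be listed in
    the order of the parts of mu. *)
Lemma mem_distinct_monomials (n : nat) (mu : seq nat) (a : {ffun 'I_n -> nat}) :
  all (leq 1) mu ->
  (a \in distinct_monomials n mu) = perm_eq mu (positive_exponents a).
Proof.
move=> mu_gt0; rewrite mem_undup; apply/mapP/idP => [[g]|].
  rewrite mem_enum => /injectiveP injg ->.
  have gE t : exponents g (g t) = nth 0%N mu t by exact: exponents_inj.
  have pos t : (0 < exponents g (g t))%N.
    by rewrite gE; apply: (all_nthP 0%N mu_gt0); apply: ltn_ord.
  have pe : perm_eq (codom g) [seq k <- enum 'I_n | (0 < exponents g k)%N].
    apply: uniq_perm; first by rewrite map_inj_uniq ?enum_uniq.
      by rewrite filter_uniq ?enum_uniq.
    move=> k; rewrite mem_filter mem_enum andbT; apply/idP/idP.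
      by case/codomP=> t ->; exact: pos.
    by apply: contraTT => /exponents_notin ->.
  rewrite /positive_exponents perm_sym -(permPl (perm_map _ pe)) codomE -map_comp.
  rewrite (eq_map gE) -[X in perm_eq _ X](mkseq_nth 0%N) /mkseq.
  by rewrite -val_enum_ord -map_comp.
case/perm_eq_map_lift => S pS muE.
have uS : uniq S by rewrite (perm_uniq pS) filter_uniq ?enum_uniq.
have szE : size mu = size S by rewrite muE size_map.
pose g := [ffun t : 'I_(size mu) => tnth (in_tuple S) (cast_ord szE t)].
have injg : injective g.
  have /tuple_uniqP injS : uniq (in_tuple S) by [].
  by move=> s t; rewrite !ffunE => /injS /cast_ord_inj.
exists g; first by rewrite mem_enum; apply/injectiveP.
apply/ffunP => k; case: (boolP (k \in codom g)) => [/codomP [t ->]|kg].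
  have gE k0 : g t = nth k0 S t by rewrite ffunE (tnth_nth k0).
  by rewrite exponents_inj// (gE (g t)) -(nth_map _ 0%N) -?szE ?ltn_ord// -muE.
rewrite exponents_notin//; apply/eqP; rewrite eqn0Ngt; apply: contra kg => ak.
have : k \in S by rewrite (perm_mem pS) mem_filter ak mem_enum.
case/(nthP k) => i iS <-; rewrite -szE in iS.
by apply/codomP; exists (Ordinal iS); rewrite ffunE (tnth_nth k).
Qed.

Lemma size_positive_exponents (n : nat) (a : {ffun 'I_n -> nat}) :
  size (positive_exponents a) = (\sum_(k < n) (0 < a k))%N.
Proof. by rewrite size_map size_filter -sum1_count big_enum_cond/= big_mkcond. Qed.

Lemma sumn_positive_exponents (n : nat) (a : {ffun 'I_n -> nat}) :
  sumn (positive_exponents a) = (\sum_(k < n) a k)%N.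
Proof.
rewrite sumnE big_map big_filter big_enum_cond/= big_mkcond/=.
by apply: eq_bigr => k _; case: (a k).
Qed.

Lemma positive_exponents_gt0 (n : nat) (a : {ffun 'I_n -> nat}) :
  all (leq 1) (positive_exponents a).
Proof. by rewrite all_map; apply/allP => k; rewrite mem_filter => /andP[]. Qed.

Lemma prod_fact_positive_exponents (K : numFieldType) (n : nat) (a : {ffun 'I_n -> nat}) :
  \prod_(b <- positive_exponents a) (b`!)%:R = \prod_(k < n) (a k)`!%:R :> K.
Proof.
rewrite big_map big_filter big_enum_cond/= big_mkcond/=.
by apply: eq_bigr => k _; case: (a k).
Qed.

(** Exponent vectors with entries at most M form a finite type, over which sums
    can be exchanged and products of sums multiplied out. *)
Definition box_exponents {n M : nat} (a : {ffun 'I_n -> 'I_M.+1}) : {ffun 'I_n -> nat} :=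
  [ffun k => val (a k)].

Lemma box_exponents_inj (n M : nat) : injective (@box_exponents n M).
Proof.
move=> a b /ffunP ab; apply/ffunP => k; apply: val_inj.
by have := ab k; rewrite !ffunE.
Qed.

(** Every part is at most M, so the box contains all the monomials; the
    factorials may be taken over all the variables since 0! = 1. *)
Lemma monomial_sym_box (K : numFieldType) (n M : nat) (mu : seq nat) (x : 'I_n -> K) :
  all (leq 1) mu -> (sumn mu <= M)%N ->
  monomial_sym mu x / \prod_(b <- mu) (b`!)%:R =
  \sum_(a : {ffun 'I_n -> 'I_M.+1} | perm_eq mu (positive_exponents (box_exponents a)))
    \prod_(k < n) (x k ^+ a k / (a k)`!%:R).
Proof.
move=> mu_gt0 le_mu_M; rewrite /monomial_sym mulr_suml.
pose P (a : {ffun 'I_n -> 'I_M.+1}) := perm_eq mu (positive_exponents (box_exponents a)).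
have pE : perm_eq (distinct_monomials n mu) [seq box_exponents a | a <- enum P].
  apply: uniq_perm; rewrite ?undup_uniq ?map_inj_uniq ?enum_uniq//.
    exact: box_exponents_inj.
  move=> b; rewrite mem_distinct_monomials//; apply/idP/mapP => [pb|[a + ->]].
    have bM k : (b k < M.+1)%N.
      rewrite ltnS (leq_trans _ le_mu_M)// (perm_sumn pb) sumn_positive_exponents.
      by rewrite (bigD1 k)//= leq_addr.
    have bE : b = box_exponents [ffun k => Ordinal (bM k)] by apply/ffunP => k; rewrite !ffunE.
    by exists [ffun k => Ordinal (bM k)] => //; rewrite mem_enum -topredE /= /P -bE.
  by rewrite mem_enum.
rewrite (perm_big _ pE)/= big_map big_enum_cond/=.
under eq_bigl do rewrite andbT.
apply: eq_bigr => a pa; rewrite (perm_big _ pa)/= prod_fact_positive_exponents -prodf_div.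
by apply: eq_bigr => k _; rewrite ffunE.
Qed.

(** Exchange the sums over mu and over the exponent vectors: a vector whose
    bidegree is (i, j) belongs to exactly one partition, the one obtained by
    sorting its nonzero entries. *)
Lemma E_coef_box (K : numFieldType) (n i j M : nat) : (j <= M)%N ->
  E_coef K n i j =
  \sum_(a : {ffun 'I_n -> 'I_M.+1} |
        ((\sum_(k < n) (0 < a k))%N == i) && ((\sum_(k < n) a k)%N == j))
    \prod_(k < n) (k.+1%:R^-1 ^+ a k / (a k)`!%:R).
Proof.
move=> le_j_M; rewrite /E_coef.
under eq_bigr => mu /and3P[_ mu_gt0 /eqP mu_j].
  rewrite (monomial_sym_box (M := M))// ?mu_j//; over.
have statE (a : {ffun 'I_n -> 'I_M.+1}) (pe := positive_exponents (box_exponents a)) :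
   (\sum_(k < n) (0 < a k))%N = size pe /\ (\sum_(k < n) a k)%N = sumn pe.
  rewrite size_positive_exponents sumn_positive_exponents.
  by split; apply: eq_bigr => k _; rewrite ffunE.
rewrite (exchange_big_dep
   (fun a : {ffun 'I_n -> 'I_M.+1} =>
      ((\sum_(k < n) (0 < a k))%N == i) && ((\sum_(k < n) a k)%N == j)))/=; last first.
  move=> mu a /and3P[_ _ /eqP mu_j] pa; have [-> ->] := statE a.
  by rewrite -(perm_size pa) -(perm_sumn pa) size_map size_tuple mu_j !eqxx.
apply: eq_bigr => a; have [-> ->] := statE a => /andP[/eqP szi /eqP smj].
set pe := positive_exponents _ in szi smj *.
pose s := sort geq pe.
have ps : perm_eq s pe by rewrite perm_sort.
have tot : total geq by move=> x y; exact: leq_total.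
have sjP : all (fun b => b < j.+1)%N s.
  apply/allP => b; rewrite (perm_mem ps) ltnS -smj => /perm_to_rem /perm_sumn -> /=.
  by rewrite leq_addr.
have muP : size (pmap (@insub _ _ 'I_j.+1) s : seq 'I_j.+1) == i.
  by rewrite size_pmap_sub -szi -(perm_size ps) -all_count.
have muE : map val (Tuple muP) = s.
  rewrite /= (pmap_filter (insubK _)); apply/all_filterP.
  by apply: sub_all sjP => b bj; rewrite isSome_insub.
rewrite (big_pred1 (Tuple muP))// => mu /=.
apply/idP/eqP => [/andP[/and3P[smu _ _] pmu]|->]; last first.
  rewrite muE ps andbT /is_partition sort_sorted// (perm_sumn ps) smj eqxx (perm_all _ ps).
  by rewrite positive_exponents_gt0.
apply/val_inj/(inj_map val_inj); rewrite muE.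
apply: (sorted_eq (leT := geq)); rewrite ?sort_sorted//.
- by move=> x y z /= yx zy; exact: leq_trans zy yx.
- by move=> x y; rewrite /= andbC -eqn_leq => /eqP.
- by rewrite (perm_trans pmu)// perm_sym.
Qed.

End MonomialCount.

(** * Summation of the double series *)

Section BoxSums.
Set Implicit Arguments.
Unset Strict Implicit.
Variables (K : numFieldType) (n : nat).

Definition exp_partial (N : nat) (z : K) : K := \sum_(b < N.+1) z ^+ b / b`!%:R.

Definition F_partial (N : nat) (u v : K) : K :=
  \prod_(k < n) (1 + v * (exp_partial N (u / k.+1%:R) - 1)).

Definition box_term {M : nat} (u v : K) (a : {ffun 'I_n -> 'I_M.+1}) : K :=
  \prod_(k < n) (v ^+ (0 < a k)%N * ((u / k.+1%:R) ^+ a k / (a k)`!%:R)).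

Definition box_degree {M : nat} (a : {ffun 'I_n -> 'I_M.+1}) : nat * nat :=
  ((\sum_(k < n) (0 < a k))%N, (\sum_(k < n) a k)%N).

Lemma factor_expand (N M : nat) (v z : K) : (N <= M)%N ->
  1 + v * (exp_partial N z - 1) =
  \sum_(b < M.+1 | (b <= N)%N) v ^+ (0 < b)%N * (z ^+ b / b`!%:R).
Proof.
move=> NM; have := @big_ord_widen _ 0 +%R N.+1 M.+1
  (fun b => v ^+ (0 < b)%N * (z ^+ b / b`!%:R)).
move=> /(_ NM) <-; rewrite /exp_partial !big_ord_recl /= expr0 fact0 divr1 mul1r; congr (_ + _).
by rewrite addrC addKr mulr_sumr; apply: eq_bigr => b _; rewrite expr1.
Qed.

Lemma F_partial_box (N M : nat) (u v : K) : (N <= M)%N ->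
  F_partial N u v =
  \sum_(a : {ffun 'I_n -> 'I_M.+1} | [forall k, (a k <= N)%N]) box_term u v a.
Proof.
move=> NM; rewrite /F_partial; under eq_bigr do rewrite (factor_expand _ _ NM).
rewrite (bigA_distr_big (fun b : 'I_M.+1 => (b <= N)%N)
  (fun (k : 'I_n) (b : 'I_M.+1) => v ^+ (0 < b)%N * ((u / k.+1%:R) ^+ b / b`!%:R))).
apply: eq_bigl => a; apply/ffun_onP/forallP => H k; exact: H.
Qed.

Lemma box_term_degree (M : nat) (u v : K) (a : {ffun 'I_n -> 'I_M.+1}) :
  box_term u v a = \prod_(k < n) (k.+1%:R^-1 ^+ a k / (a k)`!%:R) *
     v ^+ (box_degree a).1 * u ^+ (box_degree a).2.
Proof.
rewrite /box_degree/= !expr_sum -!big_split; apply: eq_bigr => k _ /=.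
by rewrite exprMn; ring.
Qed.

Lemma partial_sum_box (M : nat) (u v : K) (A : {fset nat * nat}) :
  (forall p, p \in A -> (p.2 <= M)%N) ->
  partial_sum (fun p => E_coef K n p.1 p.2 * v ^+ p.1 * u ^+ p.2) A =
  \sum_(a : {ffun 'I_n -> 'I_M.+1} | box_degree a \in A) box_term u v a.
Proof.
move=> AM; rewrite /partial_sum.
rewrite -(big_seq_fsetE _ _ xpredT (fun p => E_coef K n p.1 p.2 * v ^+ p.1 * u ^+ p.2))/=.
rewrite big_seq.
under eq_bigr => p pA do rewrite (E_coef_box _ _ _ (AM _ pA)) !mulr_suml.
rewrite (exchange_big_dep (fun a => box_degree a \in A))/=; last first.
  by move=> [i j] a pA /andP[/eqP si /eqP sj]; rewrite /box_degree si sj.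
apply: eq_bigr => a aA; rewrite box_term_degree.
rewrite (big_rem (box_degree a))//= aA /= !eqxx /= [X in _ + X]big1_seq ?addr0//.
move=> -[i j].
rewrite mem_rem_uniq ?fset_uniq// inE /= => /andP[/andP[_ /andP[/eqP si /eqP sj]]].
by rewrite /box_degree si sj eqxx.
Qed.

Lemma norm_box_term (M : nat) (u v : K) (a : {ffun 'I_n -> 'I_M.+1}) :
  `|box_term u v a| = box_term `|u| `|v| a.
Proof.
rewrite /box_term normr_prod; apply: eq_bigr => k _.
by rewrite !(normrM, normrX, normfV, normr_nat).
Qed.

(** The hypotheses say that A contains the bidegree of each vector with entries
    at most N, so what remains of the partial sum comes from vectors in the box
    of size M outside the box of size N; in absolute value these add up to at
    most the difference of the two truncated products at |u|, |v|. *)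
Lemma partial_sum_dist (N M : nat) (u v : K) (A : {fset nat * nat}) :
  (N <= M)%N -> (forall p, p \in A -> (p.2 <= M)%N) ->
  (forall p, (p.1 <= n)%N -> (p.2 <= n * N)%N -> p \in A) ->
  `|partial_sum (fun p => E_coef K n p.1 p.2 * v ^+ p.1 * u ^+ p.2) A
     - F_partial N u v| <=
  F_partial M `|u| `|v| - F_partial N `|u| `|v|.
Proof.
move=> NM AM boxA; rewrite (partial_sum_box _ _ AM) !(F_partial_box _ _ NM).
rewrite (F_partial_box _ _ (leqnn M)).
pose small (a : {ffun 'I_n -> 'I_M.+1}) := [forall k, (a k <= N)%N].
have smallA a : small a -> box_degree a \in A.
  move=> /forallP aN; apply: boxA => /=.
    rewrite -[X in (_ <= X)%N]card_ord -sum1_card.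
    by apply: leq_sum => k _; case: (0 < _)%N.
  rewrite -[X in (_ <= X * _)%N]card_ord -sum_nat_const.
  exact: leq_sum.
rewrite (bigID small)/=.
under eq_bigl => a do rewrite andbC (andb_idr (@smallA a)).
rewrite addrAC subrr add0r.
have -> : \sum_(a : {ffun 'I_n -> 'I_M.+1} | [forall k, (a k <= M)%N])
     box_term `|u| `|v| a =
   \sum_(a : {ffun 'I_n -> 'I_M.+1}) box_term `|u| `|v| a.
  by apply: eq_bigl => a; apply/forallP => k; rewrite -ltnS.
rewrite [X in _ <= X - _](bigID small)/= addrAC subrr add0r.
apply: (le_trans (ler_norm_sum _ _ _)).
rewrite big_mkcond [X in _ <= X]big_mkcond; apply: ler_sum => a _.
rewrite norm_box_term; case: (_ \in _); case: (small a) => //=.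
by rewrite -norm_box_term.
Qed.

End BoxSums.

Section Convergence.
Local Open Scope classical_set_scope.
Variables (K : numFieldType) (n : nat) (e : K -> K).
Hypothesis exp_cvg : forall z, exp_partial N z @[N --> \oo] --> e z.

Lemma F_partial_cvg (u v : K) :
  F_partial n N u v @[N --> \oo] --> \prod_(k < n) (1 + v * (e (u / k.+1%:R) - 1)).
Proof.
rewrite /F_partial; apply: cvg_big => [p|k _]; first exact: mul_continuous.
apply: cvgD; first exact: cvg_cst.
apply: cvgM; first exact: cvg_cst.
by apply: cvgB; [exact: exp_cvg|exact: cvg_cst].
Qed.

(** The bound of [partial_sum_dist] is a Cauchy difference of the sequence
    F_N(|u|, |v|), which converges; this controls all large finite sets of
    indices at once. *)
Lemma E_coef_sums (u v : K) :
  partial_sum (fun p : nat * nat => (E_coef K n p.1 p.2 * v ^+ p.1 * u ^+ p.2 : K^o))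
    @ totally --> (\prod_(k < n) (1 + v * (e (u / k.+1%:R) - 1)) : K^o).
Proof.
apply/cvgrPdist_lt => /= eps eps0.
have e3 : 0 < eps / 3 by rewrite divr_gt0.
have /cvgrPdist_lt /(_ _ e3) [N1 _ HN1] := @F_partial_cvg u v.
have /cvgrPdist_lt /(_ _ e3) [N2 _ HN2] := @F_partial_cvg `|u| `|v|.
pose N := maxn N1 N2.
pose box := [fset p in [seq (i, j) | i <- iota 0 n.+1, j <- iota 0 (n * N).+1]]%fset.
have boxP i j : (i <= n)%N -> (j <= n * N)%N -> (i, j) \in box.
  move=> i_n jN; apply/imfsetP; exists (i, j) => //.
  by apply: (allpairs_f pair); rewrite mem_iota.
exists box => // A /fsubsetP boxA.
pose M := maxn N (\max_(p <- A) p.2).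
have NM : (N <= M)%N by rewrite leq_maxl.
have AM p : p \in A -> (p.2 <= M)%N.
  move=> pA; apply: leq_trans (leq_maxr _ _).
  by rewrite (big_rem p pA) leq_maxl.
have bA p : (p.1 <= n)%N -> (p.2 <= n * N)%N -> p \in A.
  by case: p => i j /= i_n jN; apply/boxA/boxP.
have le_dist := partial_sum_dist u v NM AM bA.
set L := \prod_(k < n) _; set S := partial_sum _ A.
have -> : L - S = (L - F_partial n N u v) - (S - F_partial n N u v) by ring.
apply: (le_lt_trans (ler_normB _ _)).
have -> : eps = eps / 3 + (eps / 3 + eps / 3) by field.
apply: ltr_leD; first by apply: HN1; rewrite /= leq_maxl.
apply: (le_trans le_dist).
apply: (le_trans (real_ler_norm _)).
  by apply/ger0_real/(le_trans _ le_dist)/normr_ge0.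
set L' := \prod_(k < n) (1 + `|v| * (e (`|u| / k.+1%:R) - 1)).
have -> : F_partial n M `|u| `|v| - F_partial n N `|u| `|v| =
  (L' - F_partial n N `|u| `|v|) - (L' - F_partial n M `|u| `|v|) by ring.
apply: (le_trans (ler_normB _ _)); apply: lerD; apply/ltW/HN2 => /=.
  by rewrite leq_maxr.
by rewrite (leq_trans _ NM)// leq_maxr.
Qed.

End Convergence.

(** * The complex exponential as a power series *)

Section ExponentialAddition.
Set Implicit Arguments.
Unset Strict Implicit.
Variable K : numFieldType.

Definition exp_box_term {M : nat} (a b : K) (p : 'I_M.+1 * 'I_M.+1) : K :=
  (a ^+ p.1 / p.1`!%:R) * (b ^+ p.2 / p.2`!%:R).

(** The product of two truncated exponentials is a sum over a square of index
    pairs, and the truncated exponential of a sum ([exp_partialD_box]) is the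
    sum of the same terms over a triangle. *)
Lemma exp_partialM_box (N M : nat) (a b : K) : (N <= M)%N ->
  exp_partial N a * exp_partial N b =
  \sum_(p : 'I_M.+1 * 'I_M.+1 | (p.1 <= N)%N && (p.2 <= N)%N) exp_box_term a b p.
Proof.
move=> NM; rewrite -(pair_big (fun i : 'I_M.+1 => (i <= N)%N)
  (fun i : 'I_M.+1 => (i <= N)%N)
  (fun i j : 'I_M.+1 => (a ^+ i / i`!%:R) * (b ^+ j / j`!%:R))) -big_distrlr /=.
have wd z := @big_ord_widen _ 0 +%R N.+1 M.+1 (fun k => z ^+ k / k`!%:R : K) NM.
by rewrite /exp_partial !wd.
Qed.

Lemma exp_partialD_box (N M : nat) (a b : K) : (N <= M)%N ->
  exp_partial N (a + b) =
  \sum_(p : 'I_M.+1 * 'I_M.+1 | (p.1 + p.2 <= N)%N) exp_box_term a b p.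
Proof.
move=> NM.
rewrite (partition_big (fun p : 'I_M.+1 * 'I_M.+1 => inord (p.1 + p.2) : 'I_N.+1) xpredT)//=.
apply: eq_bigr => m _.
have mM : (m < M.+1)%N by rewrite (leq_trans (ltn_ord m)).
transitivity (\sum_(i < m.+1) (a ^+ (m - i) / (m - i)`!%:R) * (b ^+ i / i`!%:R)).
  rewrite exprDn mulr_suml; apply: eq_bigr => i _.
  have im : (i <= m)%N by rewrite -ltnS.
  have := bin_fact im => /(congr1 (fun k => k%:R : K)); rewrite !natrM => E.
  have f0 k : k`!%:R != 0 :> K by rewrite pnatr_eq0 -lt0n fact_gt0.
  have C0 : 'C(m, i)%:R != 0 :> K by rewrite pnatr_eq0 -lt0n bin_gt0.
  by rewrite -mulr_natr -E; field; rewrite !f0 C0.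
pose h (i : 'I_m.+1) : 'I_M.+1 * 'I_M.+1 := (inord (m - i), inord i).
have h1 i : (h i).1 = (m - i)%N :> nat.
  by rewrite inordK// (leq_ltn_trans (leq_subr _ _)).
have h2 i : (h i).2 = i :> nat.
  by rewrite inordK// (leq_trans (ltn_ord i)).
rewrite (reindex_onto h (fun p => inord p.2)) => [|p /andP[pN /eqP pm]]; last first.
  have pmE : (p.1 + p.2)%N = m by rewrite -pm inordK.
  have p2E : (inord p.2 : 'I_m.+1) = p.2 :> nat by rewrite inordK// ltnS -pmE leq_addl.
  case: p pmE p2E {pm pN} => p1 p2 /= pmE p2E; congr (_, _); apply: ord_inj.
    by rewrite h1 p2E -pmE addnK.
  by rewrite h2.
apply: eq_big => [i|i _]; last by rewrite /exp_box_term h1 h2.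
have im : (i <= m)%N by rewrite -ltnS.
rewrite h1 h2 subnK// -ltnS ltn_ord inord_val eqxx /=.
by apply/esym/eqP/ord_inj; rewrite inordK // h2.
Qed.

Lemma norm_exp_box_term (M : nat) (a b : K) (p : 'I_M.+1 * 'I_M.+1) :
  `|exp_box_term a b p| = exp_box_term `|a| `|b| p.
Proof. by rewrite !(normrM, normrX, normfV, normr_nat). Qed.

(** The square of side N lies between the triangles of sides N and 2N. *)
Lemma exp_partial_add_dist (N : nat) (a b : K) :
  `|exp_partial N a * exp_partial N b - exp_partial N (a + b)| <=
  exp_partial (N + N) (`|a| + `|b|) - exp_partial N (`|a| + `|b|).
Proof.
have NM := leq_addr N N.
rewrite (exp_partialM_box _ _ NM) !(exp_partialD_box _ _ NM).
rewrite (exp_partialD_box _ _ (leqnn _)).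
pose small (p : 'I_(N + N).+1 * 'I_(N + N).+1) := (p.1 + p.2 <= N)%N.
rewrite (bigID small)/=.
have small_box p : small p -> (p.1 <= N)%N && (p.2 <= N)%N.
  rewrite /small => pN; rewrite !(leq_trans _ pN) ?leq_addl ?leq_addr//.
under eq_bigl => p do rewrite andbC (andb_idr (@small_box p)).
rewrite addrAC subrr add0r [X in _ <= X - _](bigID small)/=.
under [X in _ <= X + _ - _]eq_bigl => p.
  rewrite andb_idl; last by move=> /leq_trans; apply.
  over.
rewrite addrAC subrr add0r; apply: (le_trans (ler_norm_sum _ _ _)).
rewrite big_mkcond [X in _ <= X]big_mkcond; apply: ler_sum => p _.
rewrite norm_exp_box_term; case: (small p); rewrite ?andbF// !andbT.
have [/andP[p1 p2]|_] := ifP; first by rewrite leq_add.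
by case: ifP => // _; rewrite -norm_exp_box_term.
Qed.

Local Open Scope classical_set_scope.

(** Convergence at |a| + |b| makes the difference of the truncations at 2N and
    at N tend to 0 there, and this difference bounds the defect of the addition
    formula. *)
Lemma exp_partialD_cvg (a b x y s : K) :
  exp_partial N a @[N --> \oo] --> x -> exp_partial N b @[N --> \oo] --> y ->
  exp_partial N (`|a| + `|b|) @[N --> \oo] --> s ->
  exp_partial N (a + b) @[N --> \oo] --> x * y.
Proof.
move=> ax b_y abs.
have gap : exp_partial (N + N) (`|a| + `|b|) - exp_partial N (`|a| + `|b|)
    @[N --> \oo] --> 0.
  rewrite -(subrr s); apply: cvgB => //.
  apply: (cvg_comp (fun N => (N + N)%N) (fun N => exp_partial N (`|a| + `|b|)));
    last exact: abs.
  by move=> P [M _ HM]; exists M => // N MN; apply: HM;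
    apply: leq_trans MN (leq_addr _ _).
have diff : exp_partial N a * exp_partial N b - exp_partial N (a + b) @[N --> \oo] --> 0.
  apply/cvgrPdist_lt => eps eps0.
  move/cvgrPdist_lt : gap => /(_ _ eps0); apply: filterS => N /=.
  rewrite !sub0r !normrN; apply: le_lt_trans.
  have le_gap := exp_partial_add_dist N a b.
  apply/(le_trans le_gap)/real_ler_norm/ger0_real.
  exact: le_trans (normr_ge0 _) le_gap.
rewrite -[x * y]subr0; apply: cvg_trans (cvgB (cvgM ax b_y) diff).
by apply: near_eq_cvg; apply: nearW => N /=; rewrite opprB addrC subrK.
Qed.

End ExponentialAddition.

Section ComplexExponential.
Set Implicit Arguments.
Unset Strict Implicit.
Local Open Scope classical_set_scope.
Local Open Scope complex_scope.
Variable R : realType.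
Local Notation C := R[i].

Lemma complex_cvg (f g : nat -> R) (a b : R) :
  f @ \oo --> a -> g @ \oo --> b -> (f N +i* g N : C^o) @[N --> \oo] --> (a +i* b : C^o).
Proof.
move=> /cvgrPdist_lt fa /cvgrPdist_lt gb; apply/cvgrPdist_lt => /= eps eps0.
have /andP[Ieps Reps] : (complex.Im eps == 0) && (0 < complex.Re eps).
  by move: eps0; rewrite ltcE.
have e2 : 0 < complex.Re eps / 2 by rewrite divr_gt0.
near=> N.
have -> : eps = (complex.Re eps)%:C by rewrite [LHS]complexE (eqP Ieps) mulr0 addr0.
rewrite normc_def ltcR /=.
have fN : `|a - f N| < complex.Re eps / 2 by near: N; exact: fa.
have gN : `|b - g N| < complex.Re eps / 2 by near: N; exact: gb.
have le_sqrt : Num.sqrt ((a - f N) ^+ 2 + (b - g N) ^+ 2) <= `|a - f N| + `|b - g N|.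
  rewrite -[leRHS]ger0_norm ?addr_ge0// -sqrtr_sqr ler_sqrt ?sqr_ge0//.
  by rewrite (sqrrD `|a - f N|) !real_normK ?num_real// addrAC lerDl mulrn_wge0// mulr_ge0.
by apply: (le_lt_trans le_sqrt); lra.
Unshelve. all: by end_near. Qed.

Lemma exp_partial_real (N : nat) (x : R) :
  exp_partial N (x%:C : C) = (series (exp_coeff x) N.+1)%:C.
Proof.
rewrite /exp_partial /series /= big_mkord rmorph_sum; apply: eq_bigr => k _.
by rewrite /exp_coeff /= rmorphM fmorphV rmorphXn rmorph_nat.
Qed.

Lemma exp_partial_imag (N : nat) (y : R) :
  exp_partial N (0 +i* y : C) = series (cos_coeff y) N.+1 +i* series (sin_coeff y) N.+1.
Proof.
rewrite /exp_partial /series /= !big_mkord [RHS]complexE /= !rmorph_sum mulr_sumr -big_split.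
apply: eq_bigr => k _.
have -> : 0 +i* y = 'i%C * y%:C :> C by rewrite [LHS]complexE add0r.
rewrite exprMn /cos_coeff /sin_coeff /= !rmorphM !fmorphV !rmorphXn !rmorph_nat.
rewrite rmorphN1.
have I2 : 'i%C ^+ 2 = -1 :> C by rewrite sqr_i.
rewrite -{1}(odd_double_half k) exprD -mul2n exprM I2.
case ok : (odd k) => /=; last by rewrite expr0 mul1r; ring.
have -> : k.-1./2 = k./2 by rewrite -{1}(odd_double_half k) ok add1n /= doubleK.
ring.
Qed.

(** Split z into its real and imaginary parts, where the series are those of
    exp and of cos and sin, and use the addition formula. *)
Lemma exp_partial_cvg (z : C) : exp_partial N z @[N --> \oo] --> (cexp z : C^o).
Proof.
case: z => a b; rewrite /cexp.
have shift (u : nat -> R) l : u @ \oo --> l -> u N.+1 @[N --> \oo] --> l.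
  by move=> ul; have := ul; rewrite -(cvg_shiftS u).
have expc (x : R) : exp_partial N (x%:C : C) @[N --> \oo] --> ((expR x)%:C : C^o).
  under eq_fun do rewrite exp_partial_real.
  by apply: complex_cvg; [apply/shift/is_cvg_series_exp_coeff|exact: cvg_cst].
have imc : exp_partial N (0 +i* b : C) @[N --> \oo] --> ((cos b +i* sin b) : C^o).
  under eq_fun do rewrite exp_partial_imag.
  apply: complex_cvg; apply: shift; rewrite unlock.
    exact: is_cvg_series_cos_coeff.
  exact: is_cvg_series_sin_coeff.
have -> : expR a * cos b +i* (expR a * sin b) =
    (expR a)%:C * (cos b +i* sin b) :> C by simpc.
have -> : a +i* b = a%:C + (0 +i* b) :> C by simpc.
have [r rE] : exists r : R, `|a%:C| + `|0 +i* b| = r%:C :> C.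
  by rewrite !normc_def -rmorphD; eexists.
apply: (@exp_partialD_cvg C _ _ _ _ (expR r)%:C (expc a) imc).
by rewrite rE; exact: expc.
Qed.

End ComplexExponential.

(** * Uniqueness of the coefficients of a double power series *)

Section Uniqueness.
Set Implicit Arguments.
Unset Strict Implicit.
Local Open Scope classical_set_scope.
Variable K : numFieldType.
Implicit Type d : nat -> nat -> K.

(** Once a finite set A is large, adding one index changes the partial sum by
    less than 2; the sum over A itself takes care of the indices in A. *)
Lemma cvg_totally_bounded (f : nat * nat -> K) (l : K) :
  partial_sum (f : _ -> K^o) @ totally --> (l : K^o) ->
  exists2 M : K, 0 <= M & forall p, `|f p| <= M.
Proof.
move=> /cvgrPdist_lt /(_ 1 ltr01) [A _ HA].
exists (2 + \sum_(p : A) `|f (val p)|); first by rewrite addr_ge0// sumr_ge0.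
move=> p; have [pA|pA] := boolP (p \in A).
  by rewrite (bigD1 [` pA]%fset)//= addrCA lerDl addr_ge0// sumr_ge0.
have H1 := HA A (fsubset_refl _); have H2 := HA (p |` A)%fset (fsubsetU1 _ _).
have E : f p = (l - partial_sum f A) - (l - partial_sum f (p |` A)%fset).
  rewrite /partial_sum -(big_seq_fsetE _ (p |` A)%fset xpredT f)/= big_fsetU1//=.
  by rewrite (big_seq_fsetE _ A xpredT f)/=; ring.
rewrite E; apply: (le_trans (ler_normB _ _)).
have -> : 2 = 1 + 1 :> K by ring.
by rewrite -[X in X <= _]addr0; apply: lerD; [apply: lerD; apply: ltW|apply: sumr_ge0].
Qed.

Lemma geometric_box (A : {fset nat * nat}) :
  \sum_(p <- A) (2^-1 : K) ^+ (p.1 + p.2) <= 4.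
Proof.
have geo N : \sum_(i < N) (2^-1 : K) ^+ i <= 2.
  suff -> : \sum_(i < N) (2^-1 : K) ^+ i = 2 - 2 * 2^-1 ^+ N.
    by rewrite gerBl mulr_ge0// exprn_ge0// invr_ge0.
  elim: N => [|N IH]; first by rewrite big_ord0 expr0; ring.
  by rewrite big_ord_recr /= IH exprS; field.
have [N AN] : exists N, forall p, p \in A -> (p.1 < N)%N /\ (p.2 < N)%N.
  exists (\max_(p <- A) maxn p.1 p.2).+1 => p pA.
  by apply/andP; rewrite -gtn_max ltnS (big_rem p pA) leq_maxl.
pose box := [seq (i, j) | i <- index_iota 0 N, j <- index_iota 0 N].
have pA : perm_eq A [seq p <- box | p \in A].
  apply: uniq_perm => [||[i j]]; rewrite ?fset_uniq ?filter_uniq ?allpairs_uniq ?iota_uniq//.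
    by move=> [? ?] [? ?].
  rewrite mem_filter; have [/AN [iN jN]|//] := boolP ((i, j) \in A).
  by rewrite (allpairs_f pair)// mem_index_iota.
rewrite (perm_big _ pA) big_filter big_mkcond.
apply: (@le_trans _ _ (\sum_(p <- box) (2^-1 : K) ^+ (p.1 + p.2))).
  by apply: ler_sum => p _; case: ifP => // _; rewrite exprn_ge0// invr_ge0.
rewrite big_allpairs big_mkord.
under eq_bigr => i _.
  rewrite big_mkord; under eq_bigr do rewrite exprD.
  over.
rewrite -big_distrlr /=; have -> : 4 = 2 * 2 :> K by ring.
by apply: ler_pM; rewrite ?geo// sumr_ge0// => i _; rewrite exprn_ge0// invr_ge0.
Qed.

(** If (i0, j0) is the first index in lexicographic order whose coefficient
    could be nonzero, then the weight (j0 + 1) i + j is larger than its value m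
    at (i0, j0) for every other index with a nonzero coefficient: j0 + 1 is
    large enough for i > i0 to outweigh any j.  So on the curve
    v = t^(j0+1), u = t the remaining terms are of order m + 1 in t. *)
Lemma double_series_zero (d : nat -> nat -> K) (r : K) : 0 < r ->
  (forall u v : K, `|u| < r -> `|v| < r ->
     partial_sum (fun p : nat * nat => (d p.1 p.2 * v ^+ p.1 * u ^+ p.2 : K^o)) @ totally
       --> (0 : K^o)) ->
  forall i j, d i j = 0.
Proof.
move=> r0 d0.
suff step i0 j0 : (forall i j, (i < i0)%N -> d i j = 0) ->
    (forall j, (j < j0)%N -> d i0 j = 0) ->
    d i0 j0 = 0.
  elim/ltn_ind => i IHi; elim/ltn_ind => j IHj.
  by apply: step => // i' j' /IHi.
move=> di0 dj0; pose w i j := (j0.+1 * i + j)%N.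
(* rho is a point of the domain at which the terms of the series are bounded. *)
have [rho [rho0 rhor rho1]] : exists rho : K, [/\ 0 < rho, rho < r & rho <= 1].
  have r1 : 0 < 1 + r by rewrite addr_gt0.
  exists (r / (1 + r)); split; first by rewrite divr_gt0.
    by rewrite ltr_pdivrMr// ltr_pMr// ltrDl.
  by rewrite ler_pdivrMr// mul1r lerDr.
have [M M0 HM] : exists2 M, 0 <= M &
    forall p : nat * nat, `|d p.1 p.2 * rho ^+ p.1 * rho ^+ p.2| <= M.
  by apply/cvg_totally_bounded/d0; rewrite gtr0_norm.
have dM i j : `|d i j| * rho ^+ (i + j) <= M.
  have := HM (i, j); rewrite /= -mulrA -exprD normrM.
  by rewrite [X in _ * X <= _]ger0_norm// exprn_ge0// ltW.
pose m := w i0 j0.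
(* The term of (i0, j0) has order m in t = rho * th, the other nonzero ones have
   order at least m.+1 and are dominated by a geometric series. *)
have bound th : 0 < th -> th <= 2^-1 ->
    `|d i0 j0| * rho ^+ m * th ^+ m <= M * th ^+ m.+1 * 2 ^+ m.+1 * 4.
  move=> th0 th2; pose t := rho * th.
  have th_ge0 : 0 <= th by exact: ltW.
  have th1 : th <= 1 by rewrite (le_trans th2)// invf_le1// ler1n.
  have t0 : 0 <= t by rewrite mulr_ge0// ltW.
  have tr : t < r by rewrite (le_lt_trans _ rhor)// ler_piMr// ltW.
  have t1 : t <= 1 by rewrite mulr_ile1// ltW.
  have vr : `|t ^+ j0.+1| < r.
    by rewrite ger0_norm ?exprn_ge0// (le_lt_trans _ tr)// -[X in _ <= X]expr1 ler_wiXn2l.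
  have ur : `|t| < r by rewrite ger0_norm.
  pose f (p : nat * nat) := d p.1 p.2 * (t ^+ j0.+1) ^+ p.1 * t ^+ p.2.
  have fE p : f p = d p.1 p.2 * t ^+ w p.1 p.2 by rewrite /f -mulrA -exprM -exprD.
  have tail p : p != (i0, j0) ->
      `|f p| <= M * th ^+ m.+1 * 2 ^+ m.+1 * 2^-1 ^+ (p.1 + p.2).
    case: p => i j pn; rewrite fE /= normrM [X in _ * X]ger0_norm ?exprn_ge0//.
    have [->|dn0] := eqVneq (d i j) 0.
      by rewrite normr0 mul0r !mulr_ge0 ?exprn_ge0// invr_ge0.
    have mw : (m < w i j)%N.
      rewrite /m /w; have [ii0|ii0|iE] := ltngtP i i0.
      - by rewrite di0 ?eqxx in dn0.
      - apply: (@leq_trans (j0.+1 * i0.+1)); first by rewrite mulnS addnC ltn_add2r.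
        by rewrite (leq_trans _ (leq_addr _ _))// leq_mul2l.
      - rewrite iE ltn_add2l; have [jj0|//|jE] := ltngtP j j0.
          by rewrite iE dj0 ?eqxx in dn0.
        by rewrite iE jE eqxx in pn.
    have ijw : (i + j <= w i j)%N by rewrite leq_add2r leq_pmull.
    have dw : `|d i j| * rho ^+ w i j <= M.
      by apply: (le_trans _ (dM i j)); apply: ler_wpM2l => //; rewrite ler_wiXn2l// ltW.
    (* Of the w i j factors th, keep m.+1 and bound the others by 1/2. *)
    have thw : th ^+ w i j <= th ^+ m.+1 * (2 ^+ m.+1 * 2^-1 ^+ (i + j)).
      rewrite -(subnKC mw) exprD; apply: ler_wpM2l; first exact: exprn_ge0.
      apply: (@le_trans _ _ (2^-1 ^+ (w i j - m.+1))).
        by rewrite lerXn2r// nnegrE ?invr_ge0.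
      have -> : 2^-1 ^+ (w i j - m.+1) = 2 ^+ m.+1 * 2^-1 ^+ w i j :> K.
        rewrite -[in RHS](subnKC mw) exprD mulrA -exprMn mulfV ?pnatr_eq0//.
        by rewrite expr1n mul1r.
      apply: ler_wpM2l; first exact: exprn_ge0.
      by apply: ler_wiXn2l; rewrite ?invr_ge0// invf_le1// ler1n.
    rewrite exprMn mulrA -!mulrA mulrA; apply: ler_pM => //; last by rewrite exprn_ge0.
    by rewrite mulr_ge0 ?exprn_ge0// ltW.
  have f0 : partial_sum (f : _ -> K^o) @ totally --> (0 : K^o) by exact: d0.
  apply/ler_addgt0Pr => eps eps0.
  move/cvgrPdist_lt : f0 => /(_ _ eps0) [A0 _ HA0].
  pose A := ((i0, j0) |` A0)%fset.
  have {HA0} : `|0 - partial_sum (f : _ -> K^o) A| < eps by apply: HA0; exact: fsubsetU1.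
  have p0A : (i0, j0) \in A by rewrite fset1U1.
  rewrite sub0r normrN /partial_sum -(big_seq_fsetE _ A xpredT f) /=.
  rewrite (big_rem _ p0A) /= => Seps.
  set S := \sum_(_ <- rem _ _) _ in Seps.
  have -> : `|d i0 j0| * rho ^+ m * th ^+ m = `|f (i0, j0)|.
    by rewrite fE /= normrM [ `|t ^+ _| ]ger0_norm ?exprn_ge0// exprMn mulrA.
  have S_le : `|S| <= M * th ^+ m.+1 * 2 ^+ m.+1 * 4.
    apply: (le_trans (ler_norm_sum _ _ _)).
    have c_ge0 : 0 <= M * th ^+ m.+1 * 2 ^+ m.+1 by rewrite !mulr_ge0// exprn_ge0.
    apply: (@le_trans _ _ (\sum_(p <- rem (i0, j0) A)
        M * th ^+ m.+1 * 2 ^+ m.+1 * 2^-1 ^+ (p.1 + p.2))).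
      rewrite big_seq [leRHS]big_seq; apply: ler_sum => p.
      by rewrite mem_rem_uniq ?fset_uniq// inE => /andP[/tail].
    rewrite -mulr_sumr; apply: ler_wpM2l => //.
    apply: (le_trans _ (geometric_box A)); rewrite [leRHS](big_rem _ p0A) lerDr.
    by rewrite exprn_ge0// invr_ge0.
  by rewrite -[f _](addrK S) (le_trans (ler_normB _ _))// addrC lerD// ltW.
have {}bound th : 0 < th -> th <= 2^-1 ->
    `|d i0 j0| * rho ^+ m <= (M * 2 ^+ m.+1 * 4) * th.
  move=> th0 th2; rewrite -(ler_pM2r (exprn_gt0 m th0)).
  apply: (le_trans (bound _ th0 th2)); rewrite exprS le_eqVlt.
  by apply/orP; left; apply/eqP; ring.
set B := M * _ * _ in bound.
have B0 : 0 <= B by rewrite !mulr_ge0// exprn_ge0.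
set D := `|d i0 j0| * rho ^+ m in bound.
have D0 : 0 <= D by rewrite mulr_ge0// exprn_ge0// ltW.
(* The bound D <= B * th fails at th = D / (2 * (B + D)) unless D = 0. *)
suff : D = 0.
  by move/eqP; rewrite mulf_eq0 expf_eq0 (gt_eqF rho0) andbF orbF normr_eq0 => /eqP.
apply/eqP; apply: contraT => Dn0.
have Dpos : 0 < D by rewrite lt0r Dn0.
have BD : 0 < B + D by rewrite ltr_wpDl.
have th0 : 0 < D / (2 * (B + D)) by rewrite divr_gt0// mulr_gt0.
have th2 : D / (2 * (B + D)) <= 2^-1.
  by rewrite ler_pdivrMr ?mulr_gt0// mulrA mulVf// mul1r lerDr.
have := bound _ th0 th2.
rewrite mulrA ler_pdivlMr ?mulr_gt0// [B * D]mulrC ler_pM2l//.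
have -> : 2 * (B + D) = B + (B + D + D) by ring.
by rewrite gerDl (lt_geF (addr_gt0 BD Dpos)).
Qed.

Lemma double_series_unique (c c' : nat -> nat -> K) (F : K -> K -> K) (r : K) :
  0 < r ->
  (forall u v : K, `|u| < r -> `|v| < r ->
     partial_sum (fun p => (c p.1 p.2 * v ^+ p.1 * u ^+ p.2 : K^o)) @ totally
       --> (F u v : K^o)) ->
  (forall u v : K, `|u| < r -> `|v| < r ->
     partial_sum (fun p => (c' p.1 p.2 * v ^+ p.1 * u ^+ p.2 : K^o)) @ totally
       --> (F u v : K^o)) ->
  forall i j, c i j = c' i j.
Proof.
move=> r0 cF c'F i j; apply/eqP; rewrite -subr_eq0; apply/eqP; move: i j.
apply: (double_series_zero (d := fun i j => c i j - c' i j) r0) => u v ur vr.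
rewrite -(subrr (F u v)).
apply: cvg_trans (cvgB (cF u v ur vr) (c'F u v ur vr)).
apply: near_eq_cvg; apply: nearW => A /=.
by rewrite fctE /partial_sum -sumrB; apply: eq_bigr => p _; rewrite !mulrBl.
Qed.

End Uniqueness.

(** * The generating function *)

Lemma E_coef_double_series (R : realType) (n : nat) (u v : R[i]) :
  double_series_sums_to (fun i j : nat => E_coef R[i] n i j) u v (F_fun n u v).
Proof.
rewrite /F_fun big_add1 /= big_mkord.
exact: (@E_coef_sums R[i] n (@cexp R) (@exp_partial_cvg R)).
Qed.

Theorem proposition2p1 (R : realType) (n : nat) (hn : (1 <= n)%N) :
  (forall u v : R[i],
     double_series_sums_to (fun i j : nat => E_coef R[i] n i j) u v
       (F_fun n u v)) /\
  (forall i j : nat,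
     has_coefficient (@F_fun R n) j i (E_coef R[i] n i j)).
Proof.
split=> [u v|i j]; first exact: E_coef_double_series.
split=> [|c [r r0 cF]].
  exists (fun i j => E_coef R[i] n i j); exists 1 => // u v _ _.
  exact: E_coef_double_series.
apply: (double_series_unique r0 cF) => u v _ _.
exact: E_coef_double_series.
Qed.
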